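(* Let $\mu_{\mathrm d}\in\mathbb{R}^n$ and $\Sigma_{\mathrm d}\in\mathbb{S}_n^{++}$ be given. Consider the hard-constrained covariance steering problem (HCCS): over all collections of vectors $\bar u(0),\dots,\bar u(T-1)\in\mathbb{R}^m$ and matrices $L_t\in\mathbb{R}^{m\times n}$ ($0\le t\le T-1$), $K_{(t,\tau)}\in\mathbb{R}^{m\times n}$ ($0\le\tau\le t\le T-2$), minimize $$\mathbb{E}\Big[\sum_{t=0}^{T-1}u(t)^{\mathrm T}u(t)\Big]$$ subject to $\mu_{x(T)}=\mu_{\mathrm d}$ and $\mathrm{var}_{x(T)}\preceq\Sigma_{\mathrm d}$, where $x$ and $u$ are the state and input processes of the closed-loop system described in the context. Then HCCS is equivalent to the following semidefinite program (minimization of a convex quadratic function under an affine equality constraint and a linear matrix inequality) in the variables $(\bar{\bm u},\bm{\mathcal L},\bm{\mathcal K})$: $$\begin{aligned}\min_{\bar{\bm u},\bm{\mathcal L},\bm{\mathcal K}}\quad & \bar{\bm u}^{\mathrm T}\bar{\bm u}+\operatorname{tr}(\bm{\mathcal K}\mathbf W\bm{\mathcal K}^{\mathrm T})+\operatorname{tr}(\bm{\mathcal L}\Sigma_0\bm{\mathcal L}^{\mathrm T})\\ \text{subject to}\quad & \mathbf P_{T+1}\big(\mathbf G_{\bm u}\bar{\bm u}+\mathbf G_0\mu_0\big)=\mu_{\mathrm d},\\ & \begin{bmatrix}\Sigma_{\mathrm d} & \bm\zeta(\bm{\mathcal L},\bm{\mathcal K})\\ \bm\zeta(\bm{\mathcal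 L},\bm{\mathcal K})^{\mathrm T} & I_q\end{bmatrix}\succeq 0 .\end{aligned}$$ Here equivalence means: under the one-to-one correspondence between controller parameters and triples $(\bar{\bm u},\bm{\mathcal L},\bm{\mathcal K})$ given in the context, a collection of parameters is feasible for HCCS if and only if the corresponding triple is feasible for the program, and the two objective values then coincide (so the optimal values agree and minimizers correspond to minimizers).
   Context: System. Let $T\ge1$, $A(t)\in\mathbb{R}^{n\times n}$, $B(t)\in\mathbb{R}^{n\times m}$ for $t=0,\dots,T-1$, and $$x(t+1)=A(t)x(t)+B(t)u(t)+w(t),\qquad x(0)=x_0\sim\mathcal N(\mu_0,\Sigma_0),$$ with $\mu_0\in\mathbb{R}^n$, $\Sigma_0\in\mathbb{S}_n^{++}$, where $w(0),\dots,w(T-1)$ are i.i.d. normal random vectors in $\mathbb{R}^n$ with mean $0$ and covariance $W\in\mathbb{S}_n^{+}$, independent of $x_0$. ($\mathbb{S}_n^{+}$, $\mathbb{S}_n^{++}$: symmetric positive semidefinite, resp. positive definite, $n\times n$ matrices.) For a random vector $z$, $\mu_z=\mathbb{E}[z]$ and $\mathrm{var}_z=\mathbb{E}[(z-\mu_z)(z-\mu_z)^{\mathrm T}]$. Control policy. For $t=0,\dots,T-1$, $$u(t)=\bar u(t)+L_t(x(0)-\mu_0)+\sum_{\tau=0}^{t-1}K_{(t-1,\tau)}w(\tau)$$ (empty sum for $t=0$), with $\bar u(t)\in\mathbb{R}^m$, $L_t,K_{(t,\tau)}\in\mathbb{R}^{m\times n}$. Stacked parameters. $\bar{\bm u}=[\bar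 u(0)^{\mathrm T},\dots,\bar u(T-1)^{\mathrm T}]^{\mathrm T}\in\mathbb{R}^{Tm}$; $\bm{\mathcal L}\in\mathbb{R}^{Tm\times n}$ is the vertical stacking of $L_0,\dots,L_{T-1}$; $\bm{\mathcal K}=\begin{bmatrix}\mathbf 0&\mathbf 0\\ \bm K&\mathbf 0\end{bmatrix}\in\mathbb{R}^{Tm\times Tn}$, where $\bm K\in\mathbb{R}^{(T-1)m\times(T-1)n}$ is block lower triangular with $(i,j)$ block ($0\le i,j\le T-2$) equal to $K_{(i,j)}$ if $i\ge j$ and $\mathbf 0$ otherwise. Thus $\bm{\mathcal K}$ ranges over all $T\times T$ block matrices with $m\times n$ blocks that are strictly block lower triangular, and parameters correspond one-to-one to triples $(\bar{\bm u},\bm{\mathcal L},\bm{\mathcal K})$. Stacked system matrices. $\Phi(t,\tau)=A(t-1)\cdots A(\tau)$ for $\tau<t$, $\Phi(t,t)=I$. With block rows indexed by $t=0,\dots,T$ and block columns by $\tau=0,\dots,T-1$: $\mathbf G_{\bm u}\in\mathbb{R}^{(T+1)n\times Tm}$ has $(t,\tau)$ block $\Phi(t,\tau+1)B(\tau)$ if $\tau<t$ and $\mathbf 0$ otherwise; $\mathbf G_{\bm w}\in\mathbb{R}^{(T+1)n\times Tn}$ has $(t,\tau)$ block $\Phi(t,\tau+1)$ if $\tau<t$ and $\mathbf 0$ otherwise; $\mathbf G_0\in\mathbb{R}^{(T+1)n\times n}$ has $t$-th block $\Phi(t,0)$. $\mathbf W=\mathrm{bdiag}(W,\dots,W)\in\mathbb{R}^{Tn\times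 Tn}$. $\mathbf P_{T+1}=[\mathbf 0,\dots,\mathbf 0,I_n]\in\mathbb{R}^{n\times(T+1)n}$. The map $\bm\zeta$. Fix a matrix $\mathbf R\in\mathbb{R}^{(T+1)n\times q}$ with $\mathbf R\mathbf R^{\mathrm T}=\mathrm{bdiag}(\Sigma_0,\mathbf W)$, and set $$\bm\zeta(\bm{\mathcal L},\bm{\mathcal K})=\mathbf P_{T+1}\,[\,\mathbf G_0+\mathbf G_{\bm u}\bm{\mathcal L}\ \ \ \mathbf G_{\bm w}+\mathbf G_{\bm u}\bm{\mathcal K}\,]\,\mathbf R\in\mathbb{R}^{n\times q}.$$ *)

(* Defs.v *)
From HB Require Import structures.
From mathcomp Require Import all_boot all_order all_algebra.
From mathcomp Require Import all_classical all_reals all_analysis.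

Set Implicit Arguments.
Unset Strict Implicit.
Unset Printing Implicit Defensive.

Import Order.TTheory GRing.Theory Num.Theory.
Import numFieldNormedType.Exports.

Local Open Scope classical_set_scope.
Local Open Scope ring_scope.

Notation blocks T n := (\sum_(t < T) n)%N.

Notation sdp_var R T n m :=
  ('cV[R]_(blocks T m) * 'M[R]_(blocks T m, n)
   * 'M[R]_(blocks T m, blocks T n))%type.

Section Matrices.
Variable R : realType.

Definition psdmx n (M : 'M[R]_n) : Prop :=
  M^T = M /\ forall x : 'cV[R]_n, 0 <= (x^T *m M *m x) 0 0.

Definition pdmx n (M : 'M[R]_n) : Prop :=
  M^T = M /\ forall x : 'cV[R]_n, x != 0 -> 0 < (x^T *m M *m x) 0 0.

Definition loewner_le n (M N : 'M[R]_n) : Prop := psdmx (N - M).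

Definition affine_map (U V : lmodType R) (f : U -> V) : Prop :=
  exists (l : {linear U -> V}) (c : V), forall x, f x = l x + c.

(* The leading part is given by a bilinear form [b]; the linear part and the
   constant are those of the affine map [l]. *)
Definition quadratic_fun (U : lmodType R) (f : U -> R) : Prop :=
  exists (b : U -> U -> R^o) (l : U -> R^o),
    [/\ forall x, linear (b x), forall y, linear (b^~ y), affine_map l
      & forall x, f x = b x x + l x].

End Matrices.

Section RandomVectors.
Context {R : realType} {d : measure_display} {Omega : measurableType d}.
Variable P : probability Omega R.

Definition borel_vec n := g_sigma_algebraType (@open 'cV[R]_n).

(* [normal_prob m 0] is not the point mass at [m] in the library, so the
   degenerate case is treated apart; [v] is the variance. *)
Definition normal_law (m v : R) (A : set R) : \bar R :=
  if v == 0 then \d_m A else normal_prob m (Num.sqrt v) A.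

(* Possibly degenerate N(mu, Sigma): every linear functional is normal. *)
Definition normal_vec n (X : Omega -> 'cV[R]_n) (mu : 'cV[R]_n) (Sigma : 'M[R]_n)
    : Prop :=
  measurable_fun setT (X : Omega -> borel_vec n) /\
  forall (a : 'cV[R]_n) (A : set R), measurable A ->
    P ((fun omega => (a^T *m X omega) 0 0) @^-1` A) =
    normal_law ((a^T *m mu) 0 0) ((a^T *m Sigma *m a) 0 0) A.

Definition mutually_independent n (I : finType) (X : I -> Omega -> 'cV[R]_n)
    : Prop :=
  forall (J : {set I}) (A : I -> set (borel_vec n)),
    (forall i, measurable (A i)) ->
    P (\bigcap_(i in [set` J]) (X i @^-1` A i)) =
    (\prod_(i in J) P (X i @^-1` A i))%E.

(* Entries are real: [fine] is harmless on square-integrable vectors. *)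
Definition mean_vec n (X : Omega -> 'cV[R]_n) : 'cV[R]_n :=
  \col_i fine 'E_P[fun omega => X omega i 0].

Definition var_mx n (X : Omega -> 'cV[R]_n) : 'M[R]_n :=
  let Y omega := X omega - mean_vec X in
  \matrix_(i, j) fine 'E_P[fun omega => (Y omega *m (Y omega)^T) i j].

End RandomVectors.

Section Minimization.
Context {R : realType} {U : Type}.

Definition minimizer (feasible : set U) (cost : U -> \bar R) (p : U) : Prop :=
  feasible p /\ forall p', feasible p' -> (cost p <= cost p')%E.

Definition optimal_value (feasible : set U) (cost : U -> \bar R) : \bar R :=
  ereal_inf (cost @` feasible).

End Minimization.

(* Value at [t] of a family indexed by 0..T-1, with the junk value 0 at t >= T
   (never used for the horizons considered). *)
Definition at_time (T : nat) (V : zmodType) (f : 'I_T -> V) (t : nat) : V :=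
  if insub t is Some i then f i else 0.

Section Controller.
Variables (R : realType) (T n m : nat).

(* Pairs (t, tau) with 0 <= tau <= t <= T-2; for T = 1 there is none. *)
Definition gain_index := {k : nat * nat | (k.2 <= k.1 < T.-1)%N}.

Record controller := Controller {
  ctrl_mean : 'I_T -> 'cV[R]_m;
  ctrl_init : 'I_T -> 'M[R]_(m, n);
  ctrl_noise : gain_index -> 'M[R]_(m, n)
}.

Definition noise_gain (p : controller) (t tau : nat) : 'M[R]_(m, n) :=
  if insub (t, tau) is Some k then ctrl_noise p k else 0.

Definition stacked_mean (p : controller) : 'cV[R]_(blocks T m) :=
  \mxcol_(t < T) ctrl_mean p t.

Definition stacked_init (p : controller) : 'M[R]_(blocks T m, n) :=
  \mxcol_(t < T) ctrl_init p t.

Definition stacked_noise (p : controller) : 'M[R]_(blocks T m, blocks T n) :=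
  \mxblock_(t < T, tau < T)
    (if (tau < t)%N then noise_gain p t.-1 tau else 0).

Definition stack (p : controller) : sdp_var R T n m :=
  (stacked_mean p, stacked_init p, stacked_noise p).

Definition strictly_block_lower (K : 'M[R]_(blocks T m, blocks T n)) : Prop :=
  forall t tau : 'I_T, (t <= tau)%N ->
    @submxblock R T T (fun=> m) (fun=> n) K t tau = 0.

Definition sdp_space : set (sdp_var R T n m) := [set v | strictly_block_lower v.2].

End Controller.

Section System.
Context {R : realType} {T n m : nat}.
Variables (A : 'I_T -> 'M[R]_n) (B : 'I_T -> 'M[R]_(n, m)).

Fixpoint trajectory (x0 : 'cV[R]_n) (u : 'I_T -> 'cV[R]_m)
    (w : 'I_T -> 'cV[R]_n) (t : nat) : 'cV[R]_n :=
  if t is s.+1 then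
    at_time A s *m trajectory x0 u w s + at_time B s *m at_time u s
      + at_time w s
  else x0.

Definition policy (mu0 : 'cV[R]_n) (p : controller R T n m) (x0 : 'cV[R]_n)
    (w : 'I_T -> 'cV[R]_n) (t : 'I_T) : 'cV[R]_m :=
  ctrl_mean p t + ctrl_init p t *m (x0 - mu0)
    + \sum_(tau < T | (tau < t)%N) noise_gain p t.-1 tau *m w tau.

(* A(t-1) *m ... *m A(tau), latest factor first; the identity if t = tau. *)
Definition transition (t tau : nat) : 'M[R]_n :=
  \big[mulmx/1%:M]_(s <- rev (index_iota tau t)) at_time A s.

Definition G_u : 'M[R]_(blocks T.+1 n, blocks T m) :=
  \mxblock_(t < T.+1, tau < T)
    (if (tau < t)%N then transition t tau.+1 *m B tau else 0).

Definition G_w : 'M[R]_(blocks T.+1 n, blocks T n) :=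
  \mxblock_(t < T.+1, tau < T)
    (if (tau < t)%N then transition t tau.+1 else 0).

Definition G_0 : 'M[R]_(blocks T.+1 n, n) := \mxcol_(t < T.+1) transition t 0.

Definition P_last : 'M[R]_(n, blocks T.+1 n) :=
  \mxrow_(t < T.+1) (if t == ord_max then 1%:M else 0).

Definition zeta q (Rf : 'M[R]_(n + blocks T n, q))
    (L : 'M[R]_(blocks T m, n)) (K : 'M[R]_(blocks T m, blocks T n))
    : 'M[R]_(n, q) :=
  P_last *m row_mx (G_0 + G_u *m L) (G_w + G_u *m K) *m Rf.

End System.

Section HCCS.
Context {R : realType} {d : measure_display} {Omega : measurableType d}.
Variable P : probability Omega R.
Context {T n m : nat}.
Variables (A : 'I_T -> 'M[R]_n) (B : 'I_T -> 'M[R]_(n, m)).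
Variables (mu0 : 'cV[R]_n) (x0 : Omega -> 'cV[R]_n).
Variable w : 'I_T -> Omega -> 'cV[R]_n.

Definition input (p : controller R T n m) (t : 'I_T) (omega : Omega)
    : 'cV[R]_m :=
  policy mu0 p (x0 omega) (w^~ omega) t.

Definition state (p : controller R T n m) (t : nat) (omega : Omega)
    : 'cV[R]_n :=
  trajectory A B (x0 omega) ((input p)^~ omega) (w^~ omega) t.

Definition hccs_cost (p : controller R T n m) : \bar R :=
  'E_P[fun omega => \sum_(t < T) ((input p t omega)^T *m input p t omega) 0 0].

Definition hccs_feasible (mud : 'cV[R]_n) (Sd : 'M[R]_n)
    : set (controller R T n m) :=
  [set p | mean_vec P (state p T) = mud
         /\ loewner_le (var_mx P (state p T)) Sd].

End HCCS.

Section SDP.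
Context {R : realType} {T n m : nat}.
Variables (A : 'I_T -> 'M[R]_n) (B : 'I_T -> 'M[R]_(n, m)).

Definition sdp_cost (S0 W : 'M[R]_n) (v : sdp_var R T n m) : R :=
  let: (u, L, K) := v in
  (u^T *m u) 0 0 + \tr (K *m (\mxdiag_(t < T) W) *m K^T) + \tr (L *m S0 *m L^T).

Definition sdp_mean (mu0 : 'cV[R]_n) (v : sdp_var R T n m) : 'cV[R]_n :=
  let: (u, _, _) := v in P_last *m (G_u A B *m u + G_0 A *m mu0).

Definition sdp_lmi q (Rf : 'M[R]_(n + blocks T n, q)) (Sd : 'M[R]_n)
    (v : sdp_var R T n m) : 'M[R]_(n + q) :=
  let: (_, L, K) := v in
  block_mx Sd (zeta A B Rf L K) (zeta A B Rf L K)^T 1%:M.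

Definition sdp_feasible (mu0 : 'cV[R]_n) q (Rf : 'M[R]_(n + blocks T n, q))
    (mud : 'cV[R]_n) (Sd : 'M[R]_n) : set (sdp_var R T n m) :=
  [set v | [/\ sdp_space v, sdp_mean mu0 v = mud & psdmx (sdp_lmi Rf Sd v)]].

End SDP.

(* Main.v *)
(* Write the state and the input of the closed loop as deterministic parts plus
   linear images of the stacked noise Z = (x0 - mu0, w(0), ..., w(T-1)), whose
   covariance is C = bdiag(Sigma0, W, ..., W) = R R^T. The covariance of x(T) is
   then N R R^T N^T = zeta zeta^T, where zeta = N R, so the covariance constraint
   is the linear matrix inequality by a Schur complement; the cost is a squared
   mean plus a trace tr(M C M^T) with M = [L K].
   The first two moments of Z are read off its linear functionals: each one is a
   sum of independent, possibly degenerate, normal variables, whose moments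
   reduce to the integral of x^2 exp(-x^2). *)
Require Import Defs.
From HB Require Import structures.
From mathcomp Require Import all_boot all_order all_algebra.
From mathcomp Require Import all_classical all_reals all_analysis.
From mathcomp Require Import measurable_realfun ring lra.

Set Implicit Arguments.
Unset Strict Implicit.
Unset Printing Implicit Defensive.

Import Order.TTheory GRing.Theory Num.Theory.
Import numFieldNormedType.Exports.

Local Open Scope classical_set_scope.
Local Open Scope ring_scope.

(** * Moments of the Gaussian function [exp(-x^2)] *)

Section GaussianMoments.
Variable R : realType.
Notation mu := (@lebesgue_measure R).

(** Splitting the line at 0 gives two integrals over the nonnegative half-line, which reflection
    exchanges. *)
Lemma ge0_integralT_oppr (f : R -> R) : (forall x, 0 <= f x) -> continuous f ->
  (\int[mu]_x (f x)%:E = \int[mu]_x (f (- x))%:E)%E.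
Proof.
have split_opp (g : R -> R) : (forall x, 0 <= g x) -> continuous g ->
    (\int[mu]_x (g x)%:E = \int[mu]_(x in `[0%R, +oo[) (g x)%:E
      + \int[mu]_(x in `[0%R, +oo[) (g (- x))%:E)%E.
  move=> g0 cg; have mg : measurable_fun [set: R] (EFin \o g).
    by apply/measurable_EFinP; exact: continuous_measurable_fun.
  rewrite -(setUv `[0%R, +oo[%classic) ge0_integral_setU//=; last 4 first.
    exact: measurableC.
    by rewrite setUv.
    by move=> x _; rewrite lee_fin.
    exact/disj_setPCl.
  congr (_ + _)%E.
  rewrite setCitvr integral_itv_bndo_bndc; last exact/measurable_funTS.
  rewrite -[in LHS]oppr0 ge0_integration_by_substitutionNy//.
  exact: continuous_subspaceT.
move=> f0 cf; rewrite (split_opp f)// (split_opp (f \o -%R))//=; last first.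
  by move=> x; apply: continuous_comp; [exact: opp_continuous|exact: cf].
under [X in _ = (_ + X)%E]eq_integral do rewrite opprK.
exact: addeC.
Qed.

Let g := @gauss_fun R.

Let cg : continuous g. Proof. exact: continuous_gauss_fun. Qed.

Let g0 x : 0 <= g x. Proof. exact: gauss_fun_ge0. Qed.

(** From [1 + x^2 <= exp(x^2)]. It controls the decay at infinity and makes the integrand [f] of the
    second-moment computation nonnegative. *)
Lemma gauss_fun_le_oneDsqrV (x : R) : gauss_fun x <= (oneDsqr x)^-1.
Proof.
rewrite /gauss_fun expRN lef_pV2 ?posrE ?expR_gt0 ?oneDsqr_gt0//.
exact: expR_ge1Dx.
Qed.

(** Squeezed between 0 and [1/x], as [x/(1 + x^2) <= 1/x] for [x > 0]; this is the boundary term at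
    infinity of the primitive used below. *)
Lemma cvg_id_gauss_fun : x * gauss_fun x @[x --> +oo%R] --> (0 : R).
Proof.
apply: (@squeeze_cvgr _ _ _ _ (cst 0) (fun x => x^-1)).
- near=> x; have x0 : 0 < x by near: x; exact: nbhs_pinfty_gt.
  rewrite /= mulr_ge0 ?gauss_fun_ge0 ?(ltW x0)//= -[leRHS]div1r ler_pdivlMr//.
  rewrite mulrAC -expr2 -ler_pdivlMl; last by rewrite exprn_gt0.
  rewrite mulr1 (le_trans (gauss_fun_le_oneDsqrV x))//.
  by rewrite lef_pV2 ?posrE ?oneDsqr_gt0 ?exprn_gt0// /oneDsqr lerDr.
- exact: cvg_cst.
- apply/gtr0_cvgV0; [exact: nbhs_pinfty_gt|exact: cvg_id].
Unshelve. all: by end_near. Qed.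

Let is_derive_g (x : R) : is_derive x 1 g (- 2 * x * g x).
Proof.
rewrite /g /gauss_fun; apply: is_derive_eq.
rewrite /= /GRing.scale /=; ring.
Qed.

Let continuous_sqrg : continuous (fun x : R => 2 * x ^+ 2 * g x).
Proof.
move=> x; apply: cvgM; last exact: cg.
by apply: cvgM; [exact: cvg_cst|exact: exprn_continuous].
Qed.

Let sqr_gauss_ge0 (x : R) : 0 <= 2 * x ^+ 2 * g x.
Proof. by rewrite mulr_ge0// mulr_ge0// sqr_ge0. Qed.

(* atan x - x exp(-x^2) is a primitive of (1 + x^2)^-1 - exp(-x^2) + 2 x^2 exp(-x^2),
   which is nonnegative, as the fundamental theorem on [0, +oo[ requires. *)
Lemma integral0y_sqr_gauss :
  (\int[mu]_(x in `[0%R, +oo[) (2 * x ^+ 2 * gauss_fun x)%:E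
    = (Num.sqrt pi / 2)%:E)%E.
Proof.
pose f x : R := (oneDsqr x)^-1 - g x + 2 * x ^+ 2 * g x.
have f0 x : 0 <= f x.
  by rewrite addr_ge0// subr_ge0 gauss_fun_le_oneDsqrV.
have cf : continuous f.
  move=> x; apply: cvgD; last exact: continuous_sqrg.
  by apply: cvgB; [exact: continuous_oneDsqrV|exact: cg].
have intD (h k : R -> R) : (forall x, 0 <= h x) -> continuous h ->
    (forall x, 0 <= k x) -> continuous k ->
    (\int[mu]_(x in `[0%R, +oo[) (h x + k x)%:E = \int[mu]_(x in `[0%R, +oo[)
      (h x)%:E + \int[mu]_(x in `[0%R, +oo[) (k x)%:E)%E.
  move=> h0 ch k0 ck; under eq_integral do rewrite EFinD.
  rewrite ge0_integralD//; do ?by move=> x _; rewrite lee_fin.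
  - by apply/measurable_EFinP/measurable_funTS; exact: continuous_measurable_fun.
  - by apply/measurable_EFinP/measurable_funTS; exact: continuous_measurable_fun.
have intf : (\int[mu]_(x in `[0%R, +oo[) (f x)%:E = (pi / 2)%:E)%E.
  have dF (x : R) : is_derive x 1 (fun x : R => atan x - x * g x) (f x).
    apply: is_derive_eq; rewrite /= /GRing.scale /= /f /oneDsqr /g /gauss_fun; ring.
  rewrite (@ge0_continuous_FTC2y _ f (fun x => atan x - x * g x) 0 (pi / 2))//.
  - by rewrite atan0 mul0r subr0 sube0.
  - exact: continuous_subspaceT.
  - rewrite -[X in _ --> X]subr0; apply: cvgB; first exact: cvgy_atan.
    exact: cvg_id_gauss_fun.
  - apply: cvg_at_right_filter.
    have : {for 0, continuous (fun x => atan x - x * g x)}.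
      by apply/differentiable_continuous/derivable1_diffP.
    by apply.
  - by move=> x _; rewrite derive1E; exact: derive_val.
(* One nonnegative function is split in two ways, so no integrals are subtracted before they are
   known to be finite. The integrals of [f] and of [(1 + x^2)^-1] are both [pi / 2] and cancel,
   leaving that of [g]. *)
have : (\int[mu]_(x in `[0%R, +oo[) (f x + g x)%:E =
    \int[mu]_(x in `[0%R, +oo[) ((oneDsqr x)^-1 + 2 * x ^+ 2 * g x)%:E)%E.
  by apply: eq_integral => x _; congr EFin; rewrite /f; ring.
rewrite (intD f g)// (intD (fun x => (oneDsqr x)^-1) (fun x => 2 * x ^+ 2 * g x))//;
  do ?[exact: continuous_oneDsqrV | by move=> x; rewrite invr_ge0].
rewrite intf integral0y_gauss integral0y_oneDsqr.
move/esym/(congr1 (fun z => z - (pi / 2)%:E)%E).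
by rewrite ![((pi / 2)%:E + _)%E]addeC !addeK.
Qed.

Lemma integralT_sqr_gauss :
  (\int[mu]_x (2 * x ^+ 2 * gauss_fun x)%:E = (Num.sqrt pi)%:E)%E.
Proof.
rewrite (ge0_symfun_integralT sqr_gauss_ge0 continuous_sqrg); last first.
  by move=> x; rewrite /= sqrrN /g /gauss_fun sqrrN.
by rewrite -set_itvcy integral0y_sqr_gauss -EFinM; congr EFin; field.
Qed.

Lemma integrableT_sqr_gauss :
  mu.-integrable setT (fun x => (2 * x ^+ 2 * gauss_fun x)%:E).
Proof.
apply/integrableP; split.
  by apply/measurable_EFinP; exact: continuous_measurable_fun.
under eq_integral.
  move=> x _; rewrite gee0_abs; last first.
    by rewrite lee_fin sqr_gauss_ge0.
  over.
by rewrite integralT_sqr_gauss ltry.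
Qed.

(** Domination by [(1 + 2 x^2) exp(-x^2)], since [|x| <= 1 + 2 x^2]. *)
Lemma integrableT_id_gauss :
  mu.-integrable setT (fun x => (x * gauss_fun x)%:E).
Proof.
apply: (@le_integrable _ _ _ mu setT measurableT _
  (fun x => (g x)%:E + (2 * x ^+ 2 * g x)%:E)%E).
- apply/measurable_EFinP; apply: continuous_measurable_fun => x.
  by apply: cvgM; [exact: cvg_id|exact: cg].
- move=> x _; rewrite -EFinD !abse_EFin lee_fin normrM (ger0_norm (g0 x)).
  rewrite [leRHS]ger0_norm ?addr_ge0// (_ : _ + _ = (1 + 2 * x ^+ 2) * g x); last by ring.
  rewrite ler_wpM2r//.
  have := sqr_ge0 (`|x| - 1); have := sqr_ge0 `|x|.
  by rewrite -(real_normK (num_real x)); nra.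
- exact: integrableD (@integrableT_gauss R) integrableT_sqr_gauss.
Qed.

(** The first moment, carried as an unknown until the affine formula below forces it to vanish. *)
Let kappa := fine (\int[mu]_x (x * gauss_fun x)%:E)%E.

Let integralT_affine_sqr_gauss_kappa (a b : R) :
  (\int[mu]_x ((a + b * x) ^+ 2 * gauss_fun x)%:E
    = (Num.sqrt pi * (a ^+ 2 + b ^+ 2 / 2) + 2 * a * b * kappa)%:E)%E.
Proof.
transitivity (\int[mu]_x ((a ^+ 2)%:E * (g x)%:E
    + ((b ^+ 2 / 2)%:E * (2 * x ^+ 2 * g x)%:E + (2 * a * b)%:E * (x * g x)%:E)))%E.
  by apply: eq_integral => x _; rewrite -!EFinM -!EFinD; congr EFin; rewrite /g; field.
have intg := @integrableT_gauss R.
rewrite integralD//; [|exact: integrableZl|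
  by apply: integrableD => //; apply: integrableZl => //;
     [exact: integrableT_sqr_gauss|exact: integrableT_id_gauss]].
rewrite integralD//; [|apply: integrableZl => //; exact: integrableT_sqr_gauss|
  apply: integrableZl => //; exact: integrableT_id_gauss].
rewrite !integralZl//; [|exact: integrableT_id_gauss|exact: integrableT_sqr_gauss].
rewrite integralT_gauss integralT_sqr_gauss.
rewrite -[X in (_ + (_ + _ * X))%E]fineK; last first.
  exact: integrable_fin_num integrableT_id_gauss.
by rewrite -/kappa -!EFinM -!EFinD; congr EFin; ring.
Qed.

(* Reflection invariance is only available for nonnegative integrands, hence the
   detour through (1 + x)^2 and (1 - x)^2. *)
Let kappa0 : kappa = 0.
Proof.
have : (\int[mu]_x ((1 + 1 * x) ^+ 2 * gauss_fun x)%:E =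
        \int[mu]_x ((1 + -1 * x) ^+ 2 * gauss_fun x)%:E)%E.
  rewrite (ge0_integralT_oppr (f := fun x => (1 + 1 * x) ^+ 2 * g x)).
  - by apply: eq_integral => x _; rewrite /g /gauss_fun sqrrN; congr (_ ^+ 2 * _)%:E; ring.
  - by move=> x; rewrite mulr_ge0// sqr_ge0.
  - move=> x; apply: cvgM; last exact: cg.
    apply: (@cvg_comp _ _ _ (fun x : R => 1 + 1 * x) (fun x => x ^+ 2)).
      by apply: cvgD; [exact: cvg_cst|apply: cvgM; [exact: cvg_cst|exact: cvg_id]].
    exact: exprn_continuous.
rewrite !integralT_affine_sqr_gauss_kappa => -[]; lra.
Qed.

Lemma integralT_affine_sqr_gauss (a b : R) :
  (\int[mu]_x ((a + b * x) ^+ 2 * gauss_fun x)%:E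
    = (Num.sqrt pi * (a ^+ 2 + b ^+ 2 / 2))%:E)%E.
Proof. by rewrite integralT_affine_sqr_gauss_kappa kappa0 mulr0 addr0. Qed.

End GaussianMoments.

(** * Expectation of a product of independent variables *)

Section Independence.
Context {R : realType} {d : measure_display} {Omega : measurableType d}.
Variable P : probability Omega R.

(** Independence says that the law of the pair agrees with the product of the laws on rectangles,
    hence everywhere; Fubini then factors the integral of [z.1 * z.2]. *)
Lemma expectationM_indep (X Y : {RV P >-> R}) :
    (X : Omega -> R) \in Lfun P 1 -> (Y : Omega -> R) \in Lfun P 1 ->
    (X : Omega -> R) * (Y : Omega -> R) \in Lfun P 1 ->
    (forall A B : set R, measurable A -> measurable B ->
      P (X @^-1` A `&` Y @^-1` B) = (P (X @^-1` A) * P (Y @^-1` B))%E) ->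
  ('E_P[((X : Omega -> R) * (Y : Omega -> R))%R] = 'E_P[X] * 'E_P[Y])%E.
Proof.
move=> /Lfun1_integrable iX /Lfun1_integrable iY /Lfun1_integrable iXY indep.
pose XY omega : R * R := (X omega, Y omega).
have mXY : measurable_fun setT XY by exact: measurable_fun_pair.
pose Z : {mfun Omega >-> (R * R)%type} := mfun_Sub (mem_set mXY).
pose pX := distribution P X; pose pY := distribution P Y.
have prodE C : measurable C -> (pX \x pY)%E C = distribution P Z C.
  apply: product_measure_unique => A B mA mB.
  by rewrite /= /pX /pY /distribution /pushforward -indep.
have mxy : measurable_fun [set: R * R] (fun z => (z.1 * z.2)%:E).
  by apply/measurable_EFinP; apply: measurable_funM.
have eqZ (f : R * R -> \bar R) :
    (\int[pX \x pY]_z f z = \int[distribution P Z]_z f z)%E.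
  by apply: eq_measure_integral => C mC _; exact: prodE.
(* Fubini needs integrability under the product law, which is that of [X * Y] under [P]. *)
have ixy : (pX \x pY)%E.-integrable setT (fun z => (z.1 * z.2)%:E).
  apply/integrableP; split => //; rewrite eqZ ge0_integral_distribution//.
    by case/integrableP: iXY.
  exact: measurableT_comp.
rewrite unlock.
transitivity (\int[distribution P Z]_z (z.1 * z.2)%:E)%E.
  by rewrite integral_distribution.
rewrite -eqZ -integral12_prod_meas1//= /fubini_F /=.
transitivity (\int[pX]_x (x%:E * \int[P]_w (Y w)%:E))%E.
  apply: eq_integral => x _; under eq_integral do rewrite EFinM.
  rewrite integralZl//; first by rewrite integral_distribution.
  by apply: integrable_pushforward.
rewrite -(fineK (integrable_fin_num _ iY))//= integralZr//.
  by rewrite integral_distribution.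
by apply: integrable_pushforward.
Qed.

End Independence.

(** * Second moment of a nondegenerate normal law *)

Section NormalLaw.
Context {R : realType}.
Notation mu := (@lebesgue_measure R).

(** The Radon-Nikodym derivative of the normal law equals [normal_pdf] almost everywhere, both
    having the same integral over every measurable set. *)
Lemma ge0_integral_normal_prob (m s : R) (h : R -> R) :
    measurable_fun setT h -> (forall x, 0 <= h x) ->
  (\int[normal_prob m s]_x (h x)%:E
    = \int[mu]_x (h x * normal_pdf m s x)%:E)%E.
Proof.
move=> mh h0; have dom := normal_prob_dominates m s.
have mhE : measurable_fun setT (EFin \o h) by exact/measurable_EFinP.
rewrite -(Radon_Nikodym_SigmaFinite.change_of_variables dom)//.
have aeq : ae_eq mu setT (Radon_Nikodym_SigmaFinite.f (normal_prob m s) mu)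
    (fun x => (normal_pdf m s x)%:E).
  apply: integral_ae_eq => //.
  - exact: Radon_Nikodym_SigmaFinite.f_integrable.
  - by apply/measurable_EFinP; exact: measurable_normal_pdf.
  - by move=> A _ mA; rewrite -Radon_Nikodym_SigmaFinite.f_integral.
have mf := measurable_int _ (Radon_Nikodym_SigmaFinite.f_integrable dom).
apply: ae_eq_integral => //.
- exact: emeasurable_funM.
- by apply/measurable_EFinP/measurable_funM => //; exact: measurable_normal_pdf.
- by apply: filterS aeq => x /[apply] /= ->; rewrite EFinM.
Qed.

(** The substitution [x = m + sqrt 2 * s * y] turns the density into [exp(-y^2) / sqrt pi], and the
    affine Gaussian formula applies with [a = m - c] and [b = sqrt 2 * s]. *)
Lemma integral_normal_prob_sqr (m s c : R) : 0 < s ->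
  (\int[normal_prob m s]_x ((x - c) ^+ 2)%:E
    = ((m - c) ^+ 2 + s ^+ 2)%:E)%E.
Proof.
move=> s0; have sqrt2 : 0 < Num.sqrt (2 : R) by rewrite sqrtr_gt0.
pose b := Num.sqrt 2 * s; have b0 : 0 < b by rewrite mulr_gt0.
have b2 : b ^+ 2 = s ^+ 2 *+ 2.
  by rewrite exprMn sqr_sqrtr// mulr_natl.
have sqrtpi : 0 < Num.sqrt (pi : R) by rewrite sqrtr_gt0 pi_gt0.
have peakE : Num.sqrt (s ^+ 2 * pi *+ 2) = Num.sqrt pi * b.
  have -> : s ^+ 2 * pi *+ 2 = (Num.sqrt pi * b) ^+ 2.
    by rewrite exprMn b2 sqr_sqrtr ?pi_ge0//; ring.
  by rewrite sqrtr_sqr gtr0_norm// mulr_gt0.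
have cont_sqr : continuous (fun x : R => (x - c) ^+ 2).
  move=> x; apply: (@cvg_comp _ _ _ (fun x : R => x - c) (fun x => x ^+ 2)).
    by apply: cvgB; [exact: cvg_id|exact: cvg_cst].
  exact: exprn_continuous.
rewrite ge0_integral_normal_prob; last 2 first.
- exact: continuous_measurable_fun.
- by move=> x; exact: sqr_ge0.
pose F (y : R) := m + b * y.
have dF (y : R) : is_derive y 1 F b.
  by apply: is_derive_eq; rewrite /GRing.scale /=; ring.
have F'E : F^`()%classic = cst b.
  by apply/funext => y; rewrite derive1E derive_val.
rewrite (increasing_ge0_integration_by_substitutionT (F := F))//.
- transitivity (\int[mu]_y ((Num.sqrt pi)^-1%:E
      * ((m - c + b * y) ^+ 2 * gauss_fun y)%:E))%E.
    apply: eq_integral => y _; rewrite F'E -EFinM; congr EFin; rewrite !fctE /=.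
    rewrite normal_pdfE ?gt_eqF// /normal_peak /normal_fun /F peakE /gauss_fun /=.
    have -> : - (m + b * y - m) ^+ 2 / (s ^+ 2 *+ 2) = - y ^+ 2.
      by rewrite -b2; field; exact: lt0r_neq0.
    by field; rewrite !lt0r_neq0.
  rewrite integralZl//; last first.
    apply/integrableP; split.
      apply/measurable_EFinP/measurable_funM; last exact: measurable_gauss_fun.
      by apply: measurable_funX; apply: measurable_funD => //; exact: measurable_funM.
    under eq_integral.
      move=> y _; rewrite gee0_abs; last first.
        by rewrite lee_fin mulr_ge0 ?sqr_ge0 ?gauss_fun_ge0.
      over.
    by rewrite integralT_affine_sqr_gauss ltry.
  rewrite integralT_affine_sqr_gauss -EFinM mulKf ?lt0r_neq0// b2.
  by congr EFin; rewrite -mulr_natr mulfK.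
- by move=> x y xy; rewrite /F ltrD2l ltr_pM2l.
- by rewrite F'E => y; exact: cvg_cst.
- by rewrite F'E; exact: is_cvg_cst.
- by rewrite F'E; exact: is_cvg_cst.
- apply: (@cvg_comp _ _ _ (fun y => b * y) (fun y => m + y)); last exact: cvg_addrl_Ny.
  exact: gt0_cvgMrNy.
- apply: (@cvg_comp _ _ _ (fun y => b * y) (fun y => m + y)); last exact: cvg_addrl.
  exact: gt0_cvgMry.
- move=> x; apply: cvgM; first exact: cont_sqr.
  by apply: continuous_normal_pdf; rewrite gt_eqF.
- by move=> x; rewrite mulr_ge0 ?sqr_ge0 ?normal_pdf_ge0.
Qed.

End NormalLaw.

(** Serves the index type of the independent family: [None] is the initial state, [Some t] the noise
    at time [t]. *)
Lemma big_optionE (V : nmodType) (T : finType) (F : option T -> V) :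
  \sum_(i : option T) F i = F None + \sum_(t : T) F (Some t).
Proof.
rewrite (bigD1 None)//=; congr (_ + _).
rewrite (reindex_omap Some id)/=; last by case.
by apply: eq_bigl => t; rewrite eqxx.
Qed.

(** * Square-integrable variables and centered random vectors *)

Section Moments.
Context {R : realType} {d : measure_display} {Omega : measurableType d}.
Variable P : probability Omega R.
Implicit Types (X Y : Omega -> R).

Lemma Lfun2_1 X : X \in Lfun P 2%:E -> X \in Lfun P 1.
Proof. by apply: Lfun_subset12; exact: fin_num_measure. Qed.

Lemma Lfun2P X : measurable_fun setT X ->
  ('E_P[fun omega => (X omega ^+ 2)%R] < +oo)%E -> X \in Lfun P 2%:E.
Proof.
move=> mX; rewrite unlock => X2; apply/andP; split; rewrite inE//=.
rewrite /finite_norm unlock /Lnorm poweR_lty//.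
by under eq_integral do rewrite abse_EFin poweR_EFin powR_mulrn// real_normK ?num_real//.
Qed.

Lemma Lfun2_sqr X : X \in Lfun P 2%:E ->
  (fun omega => X omega ^+ 2) \in Lfun P 1.
Proof. by move=> X2; exact: (Lfun2_mul_Lfun1 X2 X2). Qed.

Lemma Lfun_sumr (p : \bar R) (I : Type) (r : seq I) (F : I -> Omega -> R) :
  (1 <= p)%E -> (forall i, F i \in Lfun P p) ->
  (fun omega => \sum_(i <- r) F i omega) \in Lfun P p.
Proof.
move=> p1 FP; have [L0 LD] := Lfun_addr_closed P p1.
have -> : (fun omega => \sum_(i <- r) F i omega) = \sum_(i <- r) F i.
  by apply/funext => omega; rewrite fct_sumE.
by elim/big_ind : _.
Qed.

Lemma expectation_sumr (I : Type) (r : seq I) (F : I -> Omega -> R) :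
  (forall i, F i \in Lfun P 1) ->
  ('E_P[fun omega => (\sum_(i <- r) F i omega)%R] = \sum_(i <- r) 'E_P[F i])%E.
Proof.
move=> FP; elim: r => [|i r IH].
  rewrite big_nil -[RHS](expectation_cst P (0 : R)); congr expectation.
  by apply/funext => omega; rewrite big_nil.
rewrite big_cons -IH -expectationD//; last exact: Lfun_sumr.
by congr expectation; apply/funext => omega; rewrite big_cons.
Qed.

(** The center [c] is left free because the values at two centers determine the mean. *)
Lemma normal_law_sqr_moment X (m v c : R) : measurable_fun setT X -> 0 <= v ->
  (forall A, measurable A -> P (X @^-1` A) = normal_law m v A) ->
  ('E_P[fun omega => ((X omega - c) ^+ 2)%R] = ((m - c) ^+ 2 + v)%:E)%E.
Proof.
move=> mX v0 lawX.
(* normal_prob is a measure on measurableTypeR R, whose measurable structure has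
   another display than that of R. *)
have mX' : measurable_fun setT (X : Omega -> measurableTypeR R) by exact: mX.
pose Z : {mfun Omega >-> measurableTypeR R} :=
  @mfun_Sub _ _ Omega (measurableTypeR R) X (mem_set mX').
have mf : measurable_fun [set: measurableTypeR R] (fun x : R => ((x - c) ^+ 2)%:E).
  by apply/measurable_EFinP; apply: measurable_funX; exact: measurable_funB.
rewrite unlock; transitivity (\int[distribution P Z]_x ((x - c) ^+ 2)%:E)%E.
  by rewrite ge0_integral_distribution// => x; rewrite lee_fin sqr_ge0.
have [v0'|vN0] := eqVneq v 0.
  transitivity (\int[\d_(m : measurableTypeR R)]_x ((x - c) ^+ 2)%:E)%E.
    apply: eq_measure_integral => A mA _.
    by rewrite [LHS]lawX// /normal_law v0' eqxx.
  by rewrite integral_dirac// diracT mul1e v0' addr0.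
have vgt0 : 0 < v by rewrite lt_neqAle eq_sym vN0.
rewrite -(sqr_sqrtr v0) -integral_normal_prob_sqr ?sqrtr_gt0//.
apply: eq_measure_integral => A mA _.
by rewrite [LHS]lawX// /normal_law (negbTE vN0).
Qed.

(** The second moments about [m + 1] and [m] are [1 + v] and [v], while their difference is [1 - 2
    E[X - m]]; hence the mean of [X - m] is 0. *)
Lemma normal_law_moments X (m v : R) : measurable_fun setT X -> 0 <= v ->
  (forall A, measurable A -> P (X @^-1` A) = normal_law m v A) ->
  [/\ (fun omega => X omega - m) \in Lfun P 2%:E,
      ('E_P[fun omega => (X omega - m)%R] = 0)%E
    & ('E_P[fun omega => ((X omega - m) ^+ 2)%R] = v%:E)%E].
Proof.
move=> mX v0 lawX; have EX2 c := normal_law_sqr_moment c mX v0 lawX.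
pose Y omega := X omega - m.
have Y2 : Y \in Lfun P 2%:E.
  by apply: Lfun2P; [exact: measurable_funB|rewrite EX2 ltry].
split => //; last by rewrite EX2 subrr expr0n add0r.
have Y1 := Lfun2_1 Y2; have YY := Lfun2_sqr Y2.
have : ('E_P[fun omega => ((X omega - (m + 1)) ^+ 2)%R] =
    'E_P[((fun omega => Y omega ^+ 2) \+ ((-2) \o* Y \+ cst 1))%R])%E.
  by congr expectation; apply/funext => omega; rewrite /Y /=; ring.
rewrite EX2 expectationD//; last first.
  have [_ LD] := Lfun_addr_closed P (lexx 1%E).
  by apply: LD; [apply: Lfun_scale|exact: Lfun_cst].
rewrite expectationD//; [|exact: Lfun_scale|exact: Lfun_cst].
rewrite expectationZl// expectation_cst EX2.
have := expectation_fin_num Y1; rewrite -/Y.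
case: ('E_P[Y])%E => // y _ [] H; congr EFin; lra.
Qed.

Lemma expectation_sqr_sum_uncorrelated (I : finType) (Y : I -> Omega -> R) :
  (forall i, Y i \in Lfun P 2%:E) ->
  (forall i j, i != j -> ('E_P[fun omega => (Y i omega * Y j omega)%R] = 0)%E) ->
  ('E_P[fun omega => ((\sum_i Y i omega) ^+ 2)%R]
    = \sum_i 'E_P[fun omega => (Y i omega ^+ 2)%R])%E.
Proof.
move=> Y2 Y0; have YY i j : (fun omega => Y i omega * Y j omega) \in Lfun P 1.
  exact: (Lfun2_mul_Lfun1 (Y2 i) (Y2 j)).
transitivity ('E_P[fun omega => (\sum_i \sum_j Y i omega * Y j omega)%R])%E.
  congr expectation; apply/funext => omega; rewrite expr2 mulr_suml.
  by apply: eq_bigr => i _; rewrite mulr_sumr.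
rewrite expectation_sumr; last by move=> i; exact: Lfun_sumr.
apply: eq_bigr => i _; rewrite expectation_sumr// (bigD1 i)//= big1 ?adde0//.
by move=> j ji; rewrite Y0// eq_sym.
Qed.

(* Stated on linear functionals, which is what normality provides and what linear
   maps and independent stacking preserve without computing on entries. *)
Definition centered_rv N (Z : Omega -> 'cV[R]_N) (C : 'M[R]_N) : Prop :=
  forall a : 'cV[R]_N,
  [/\ (fun omega => (a^T *m Z omega) 0 0) \in Lfun P 2%:E,
      ('E_P[fun omega => (a^T *m Z omega)%R 0%R 0%R] = 0)%E
    & ('E_P[fun omega => ((a^T *m Z omega) 0 0 ^+ 2)%R]
        = ((a^T *m C *m a)%R 0%R 0%R)%:E)%E].

(** The functional [a] of [A Z] is the functional [A^T a] of [Z]. *)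
Lemma centered_rv_mulmx N M (Z : Omega -> 'cV[R]_N) C (A : 'M[R]_(M, N)) :
  centered_rv Z C -> centered_rv (fun omega => A *m Z omega) (A *m C *m A^T).
Proof.
move=> ZC a; have := ZC (A^T *m a).
rewrite trmx_mul trmxK !mulmxA.
move=> [Z2 Z0 ZZ]; split.
- by under eq_fun do rewrite mulmxA.
- by under eq_fun do rewrite mulmxA.
- by under eq_fun do rewrite mulmxA.
Qed.

(** * Entrywise moments, mean and covariance of a centered vector *)

Section Entries.
Variables (N : nat) (Z : Omega -> 'cV[R]_N) (C : 'M[R]_N).
Hypothesis ZC : centered_rv Z C.

Let e (i : 'I_N) : 'cV[R]_N := delta_mx i 0.

Let delta_entry i omega : ((e i)^T *m Z omega) 0 0 = Z omega i 0.
Proof. by rewrite trmx_delta -rowE mxE. Qed.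

Lemma centered_rv_Lfun2 i : (fun omega => Z omega i 0) \in Lfun P 2%:E.
Proof.
by have [+ _ _] := ZC (delta_mx i 0); under eq_fun do rewrite delta_entry.
Qed.

Lemma centered_rv_expectation i : ('E_P[fun omega => Z omega i 0%R] = 0)%E.
Proof.
by have [_ + _] := ZC (delta_mx i 0); under eq_fun do rewrite delta_entry.
Qed.

Lemma centered_rv_sqr i :
  ('E_P[fun omega => (Z omega i 0 ^+ 2)%R] = (C i i)%:E)%E.
Proof.
have [_ _ +] := ZC (delta_mx i 0); under eq_fun do rewrite delta_entry.
by rewrite trmx_delta -rowE -colE !mxE.
Qed.

(** Polarization: the functional [e i + e j] yields the cross moment once the two squares are known,
    symmetry of [C] merging [C i j] with [C j i]. *)
Lemma centered_rv_mul i j : C^T = C ->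
  ('E_P[fun omega => (Z omega i 0 * Z omega j 0)%R] = (C i j)%:E)%E.
Proof.
move=> Csym; have Cji : C j i = C i j by rewrite -[in RHS]Csym mxE.
have [_ _] := ZC (e i + e j).
have L2 := centered_rv_Lfun2.
have L1 : (fun omega => Z omega i 0 * Z omega j 0) \in Lfun P 1.
  exact: (Lfun2_mul_Lfun1 (L2 i) (L2 j)).
have -> : (fun omega => (((e i + e j)^T *m Z omega) 0 0) ^+ 2)
  = (fun omega => Z omega i 0 ^+ 2) \+ ((fun omega => Z omega j 0 ^+ 2)
      \+ 2 \o* (fun omega => Z omega i 0 * Z omega j 0)).
  apply/funext => omega; rewrite linearD mulmxDl mxE !delta_entry /=; ring.
rewrite expectationD ?Lfun2_sqr//; last first.
  have [_ LD] := Lfun_addr_closed P (lexx 1%E).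
  by apply: LD; [exact: Lfun2_sqr|exact: Lfun_scale].
rewrite expectationD ?Lfun2_sqr//; last exact: Lfun_scale.
rewrite expectationZl// !centered_rv_sqr.
have -> : ((e i + e j)^T *m C *m (e i + e j)) 0 0
    = C i i + C j j + 2 * C i j :> R.
  rewrite [(e i + e j)^T]linearD /= /e !trmx_delta !mulmxDl !mulmxDr -!rowE -!colE !mxE Cji; ring.
have := expectation_fin_num L1; case: ('E_P[_])%E => // y _ [] H.
by congr EFin; lra.
Qed.

Lemma mean_vec_centered c : mean_vec P (fun omega => c + Z omega) = c.
Proof.
apply/colP => i; rewrite mxE.
transitivity (fine ('E_P[(cst (c i 0) \+ (fun omega => Z omega i 0))%R])%E).
  by congr (fine (expectation _ _)); apply/funext => omega; rewrite mxE.
rewrite expectationD ?centered_rv_expectation ?expectation_cst ?adde0//.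
  exact: Lfun_cst.
exact/Lfun2_1/centered_rv_Lfun2.
Qed.

Lemma var_mx_centered c : C^T = C -> var_mx P (fun omega => c + Z omega) = C.
Proof.
move=> Csym; apply/matrixP => i j; rewrite mxE mean_vec_centered.
transitivity (fine ('E_P[fun omega => (Z omega i 0 * Z omega j 0)%R])%E).
  congr (fine (expectation _ _)); apply/funext => omega.
  by rewrite addrC addKr !mxE big_ord1 mxE.
by rewrite centered_rv_mul.
Qed.

(** Expanding each squared entry, the cross term is linear in a centered entry and vanishes; the
    variances add up to the trace. *)
Lemma expectation_sqr_norm c :
  ('E_P[fun omega => (((c + Z omega)^T *m (c + Z omega)) 0 0)%R]
    = ((c^T *m c) 0 0 + \tr C)%:E)%E.
Proof.
have L2 := centered_rv_Lfun2; pose F i omega := (c i 0 + Z omega i 0) ^+ 2.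
have FE i : F i = cst (c i 0 ^+ 2) \+ ((2 * c i 0) \o* (fun omega => Z omega i 0)
      \+ (fun omega => Z omega i 0 ^+ 2)).
  by apply/funext => omega; rewrite /F /=; ring.
have [_ LD] := Lfun_addr_closed P (lexx 1%E).
have LZ i : (2 * c i 0) \o* (fun omega => Z omega i 0) \in Lfun P 1.
  by apply: Lfun_scale => //; exact: Lfun2_1.
have LQ i : (2 * c i 0) \o* (fun omega => Z omega i 0)
    \+ (fun omega => Z omega i 0 ^+ 2) \in Lfun P 1.
  by apply: LD => //; exact: Lfun2_sqr.
transitivity ('E_P[fun omega => (\sum_i F i omega)%R])%E.
  congr expectation; apply/funext => omega; rewrite mxE.
  by apply: eq_bigr => i _; rewrite !mxE /F expr2.
rewrite expectation_sumr; last first.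
  by move=> i; rewrite FE; apply: LD => //; exact: Lfun_cst.
rewrite mxE -big_split/= -sumEFin; apply: eq_bigr => i _.
rewrite FE expectationD//; last exact: Lfun_cst.
rewrite expectationD//; last exact: Lfun2_sqr.
rewrite expectationZl; last exact: Lfun2_1.
rewrite expectation_cst centered_rv_expectation mule0 add0e centered_rv_sqr.
by rewrite mxE expr2.
Qed.

End Entries.

End Moments.

(** * Linear functionals of normal vectors *)

Section NormalVectors.
Context {R : realType} {d : measure_display} {Omega : measurableType d}.
Variable P : probability Omega R.

(** Coordinates are continuous, hence Borel, and the functional is a finite combination of them. *)
Lemma measurable_borel_vec_functional n (a c : 'cV[R]_n) :
  measurable_fun setT ((fun v => (a^T *m (v - c)) 0 0) : @borel_vec R n -> R).
Proof.
have mcoord (k : 'I_n) : measurable_fun setT ((fun v => v k 0) : @borel_vec R n -> R).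
  apply: (measurability _ (RGenOpens.measurableE R)).
  move=> _ [_ [x [y ->] <-]]; rewrite setTI; apply: sub_sigma_algebra.
  apply: (open_comp (f := fun v : 'cV[R]_n => v k 0)); last exact: interval_open.
  by move=> v _; exact: coord_continuous.
under eq_fun do rewrite mxE.
apply: measurable_sum => k; apply: measurable_funM => //.
under eq_fun do rewrite !mxE.
by apply: measurable_funD.
Qed.

(** Each functional of [X] has a scalar [normal_law], whose variance is nonnegative because [S] is
    positive semidefinite; centering [X] shifts it by [a^T c]. *)
Lemma normal_vec_centered n (X : Omega -> 'cV[R]_n) c (S : 'M[R]_n) :
  normal_vec P X c S -> psdmx S -> centered_rv P (fun omega => X omega - c) S.
Proof.
move=> [mX lawX] [_ S0] a; pose Y omega := (a^T *m X omega) 0 0.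
have mY : measurable_fun setT Y.
  have := measurableT_comp (measurable_borel_vec_functional a 0) mX.
  by apply: eq_measurable_fun => omega _; rewrite /= subr0.
have YE : (fun omega => (a^T *m (X omega - c)) 0 0)
    = (fun omega => Y omega - (a^T *m c) 0 0).
  by apply/funext => omega; rewrite mulmxBr mxE [X in _ + X]mxE.
have [Y2 Y0 YY] := normal_law_moments mY (S0 a) (lawX a).
split; rewrite ?YE//; rewrite -YY; congr expectation; apply/funext => omega.
by rewrite (congr1 (fun f => f omega) YE).
Qed.

(** Events about the functionals are Borel events about the vectors, so the expectation of the
    product factors, and the means are 0. *)
Lemma indep_functional_uncorrelated n (X1 X2 : Omega -> 'cV[R]_n) (c1 c2 : 'cV[R]_n)
    (S1 S2 : 'M[R]_n) (a1 a2 : 'cV[R]_n) :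
  normal_vec P X1 c1 S1 -> normal_vec P X2 c2 S2 -> psdmx S1 -> psdmx S2 ->
  (forall A1 A2 : set (@borel_vec R n), measurable A1 -> measurable A2 ->
    P (X1 @^-1` A1 `&` X2 @^-1` A2) = (P (X1 @^-1` A1) * P (X2 @^-1` A2))%E) ->
  ('E_P[fun omega => ((a1^T *m (X1 omega - c1)) 0 0 * (a2^T *m (X2 omega - c2)) 0 0)%R] = 0)%E.
Proof.
move=> nX1 nX2 psd1 psd2 indep.
have [Y1L Y10 _] := normal_vec_centered nX1 psd1 a1.
have [Y2L Y20 _] := normal_vec_centered nX2 psd2 a2.
have m1 := measurableT_comp (measurable_borel_vec_functional a1 c1) nX1.1.
have m2 := measurableT_comp (measurable_borel_vec_functional a2 c2) nX2.1.
pose Y1 : {RV P >-> R} := mfun_Sub (mem_set m1).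
pose Y2 : {RV P >-> R} := mfun_Sub (mem_set m2).
have := @expectationM_indep _ _ _ P Y1 Y2.
rewrite [X in (_ = X * _)%E]Y10 mul0e; apply.
- exact: Lfun2_1.
- exact: Lfun2_1.
- exact: Lfun2_mul_Lfun1.
- move=> A1 A2 mA1 mA2.
  have mf1 := measurable_borel_vec_functional a1 c1 measurableT mA1.
  have mf2 := measurable_borel_vec_functional a2 c2 measurableT mA2.
  rewrite setTI in mf1; rewrite setTI in mf2.
  exact: indep mf1 mf2.
Qed.

End NormalVectors.

(** * Schur complement *)

Section BlockAlgebra.
Variable R : realType.

(** Completing the square: the block form at [(y, v)] is [y^T (S - Z Z^T) y] plus the squared norm
    of [v + Z^T y]. *)
Lemma psdmx_schur n q (S : 'M[R]_n) (Z : 'M[R]_(n, q)) : S^T = S ->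
  psdmx (block_mx S Z Z^T 1%:M) <-> psdmx (S - Z *m Z^T).
Proof.
move=> Ssym.
have quadE (y : 'cV[R]_n) (v : 'cV[R]_q) :
    (col_mx y v)^T *m block_mx S Z Z^T 1%:M *m col_mx y v
    = y^T *m (S - Z *m Z^T) *m y + (v + Z^T *m y)^T *m (v + Z^T *m y).
  rewrite tr_col_mx mul_row_block mul_row_col mulmx1.
  rewrite [(v + _)^T]linearD /= trmx_mul trmxK !(mulmxDl, mulmxDr) mulmxN mulNmx !mulmxA.
  move: (y^T *m S *m y) (v^T *m Z^T *m y) (y^T *m Z *m v) (v^T *m v).
  move: (y^T *m Z *m Z^T *m y) => a b c e f.
  by apply/matrixP => i j; rewrite !mxE; ring.
have sq_ge0 (v : 'cV[R]_q) : 0 <= (v^T *m v) 0 0.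
  by rewrite mxE sumr_ge0// => k _; rewrite mxE -expr2 sqr_ge0.
split=> -[_ psd]; split.
- by rewrite linearB /= trmx_mul trmxK Ssym.
(* This choice of the second component cancels the square. *)
- move=> y; have := psd (col_mx y (- (Z^T *m y))).
  by rewrite quadE addNr mulmx0 addr0.
- by rewrite tr_block_mx trmxK trmx1 Ssym.
- move=> x; rewrite -(vsubmxK x) quadE mxE; apply: addr_ge0; [exact: psd|exact: sq_ge0].
Qed.

End BlockAlgebra.

(** * Stacked form of the trajectory and of the policy *)

Section Trajectory.
Variables (R : realType) (T n m : nat).
Variables (A : 'I_T -> 'M[R]_n) (B : 'I_T -> 'M[R]_(n, m)).

Lemma transition_id t : transition A t t = 1%:M.
Proof. by rewrite /transition /index_iota subnn big_nil. Qed.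

Lemma transitionS t tau : (tau <= t)%N ->
  transition A t.+1 tau = at_time A t *m transition A t tau.
Proof.
move=> le_tau; rewrite /transition /index_iota subSn// -addn1 iotaD subnKC//.
by rewrite cats1 rev_rcons big_cons.
Qed.

Lemma at_time_ord (V : zmodType) (f : 'I_T -> V) (t : 'I_T) : at_time f t = f t.
Proof. by rewrite /at_time valK. Qed.

(** Variation of constants: from [t] to [t.+1] every earlier term gains the left factor [A(t)], and
    the new term [tau = t] enters with the identity transition. *)
Lemma trajectoryE x0 (u : 'I_T -> 'cV[R]_m) (w : 'I_T -> 'cV[R]_n) t :
  (t <= T)%N ->
  trajectory A B x0 u w t = transition A t 0 *m x0
    + \sum_(tau < T | (tau < t)%N)
        transition A t tau.+1 *m (B tau *m u tau + w tau).
Proof.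
elim: t => [_|t IH tT] /=.
  by rewrite transition_id mul1mx big_pred0 ?addr0.
pose t' := Ordinal tT.
rewrite IH; last exact: ltnW.
(* As [t < T], the lookups return actual data and never the default 0. *)
rewrite (at_time_ord B t') (at_time_ord u t') (at_time_ord w t').
rewrite [in RHS](bigD1 t')//= transition_id mul1mx transitionS//.
rewrite mulmxDr mulmxA -!addrA; congr (_ + _).
rewrite addrC -!addrA; congr (_ + (_ + _)).
rewrite mulmx_sumr; apply: eq_big => [tau|tau ltau].
  by rewrite -val_eqE /= ltnS andbC ltn_neqAle.
by rewrite transitionS// mulmxA.
Qed.

Lemma P_last_mxcol p (X : 'I_T.+1 -> 'M[R]_(n, p)) :
  P_last *m (\mxcol_(t < T.+1) X t) = X ord_max.
Proof.
rewrite /P_last mul_mxrow_mxcol (bigD1 ord_max)//= eqxx mul1mx big1 ?addr0//.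
by move=> t /negbTE ->; rewrite mul0mx.
Qed.

(** [P_last] selects the block row [t = T], where the guard [tau < t] holds for every [tau]. *)
Lemma trajectory_stacked x0 (u : 'I_T -> 'cV[R]_m) (w : 'I_T -> 'cV[R]_n) :
  trajectory A B x0 u w T = P_last *m (G_0 A *m x0
    + G_u A B *m (\mxcol_(t < T) u t) + G_w A *m (\mxcol_(t < T) w t)).
Proof.
rewrite trajectoryE// !mulmxDr !mulmxA.
rewrite -[P_last *m G_0 A]/(_ *m _) P_last_mxcol -!mulmxA.
rewrite !mul_mxblock_mxrow !P_last_mxcol -addrA -big_split /=.
congr (_ + _); apply: eq_big => [tau|tau _]; first by rewrite ltn_ord.
by rewrite ltn_ord mulmxDr mulmxA.
Qed.

(** The zero blocks of [stacked_noise] on and above the diagonal account for the guard [tau < t] in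
    the policy. *)
Lemma policy_stacked mu0 (p : controller R T n m) x0 (w : 'I_T -> 'cV[R]_n) :
  \mxcol_(t < T) policy mu0 p x0 w t = stacked_mean p
    + row_mx (stacked_init p) (stacked_noise p)
      *m col_mx (x0 - mu0) (\mxcol_(t < T) w t).
Proof.
rewrite mul_row_col mul_mxblock_mxrow mxcol_mul -!mxcolD.
apply/eq_mxcolP => t; rewrite /policy -addrA; congr (_ + (_ + _)).
rewrite big_mkcond /=; apply: eq_bigr => tau _.
by case: ifP => // _; rewrite mul0mx.
Qed.

End Trajectory.

(** * Bijection between controllers and strictly lower triangular triples *)

Section Stack.
Variables (R : realType) (T n m : nat).

Lemma stack_inj : injective (@stack R T n m).
Proof.
move=> [u1 L1 K1] [u2 L2 K2] [uE LE KE].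
have -> : u1 = u2.
  apply/funext => t; have := congr1 (fun M => submxcol M t) uE.
  by rewrite !mxcolK.
have -> : L1 = L2.
  apply/funext => t; have := congr1 (fun M => submxcol M t) LE.
  by rewrite !mxcolK.
suff -> : K1 = K2 by [].
apply/funext => k; have /andP[k21 k1T] := valP k.
(* The gain of index [(k1, k2)] is stored in block [(k1 + 1, k2)], which is in range because
   [k1 < T - 1]. *)
have kT : ((val k).1.+1 < T)%N by rewrite -ltn_predRL.
have := congr1 (fun M => submxblock M (Ordinal kT) (Ordinal (leq_ltn_trans k21 (ltnW kT)))) KE.
by rewrite !mxblockK /= ltnS k21 /noise_gain -surjective_pairing !valK.
Qed.

(* Both lookups succeed on a gain index; the zeros are never used. *)
Definition unstack (v : sdp_var R T n m) : controller R T n m :=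
  Controller (fun t => submxcol (v.1.1 : 'cV[R]_(blocks T m)) t)
    (fun t => submxcol (v.1.2 : 'M[R]_(blocks T m, n)) t)
    (fun k : gain_index T =>
      if insub (val k).1.+1 is Some t then
        if insub (val k).2 is Some tau then
          (submxblock (v.2 : 'M[R]_(blocks T m, blocks T n)) t tau : 'M[R]_(m, n))
        else 0
      else 0).

Lemma unstackK v : sdp_space v -> stack (unstack v) = v.
Proof.
case: v => [[u L] K] /= lowK; rewrite /stack; congr (_, _, _).
- exact: submxcolK.
- exact: submxcolK.
- rewrite -[RHS]submxblockK; apply/eq_mxblockP => t tau.
  (* On and above the diagonal both blocks are 0. Below it [t > 0], and the gain index is
     [(t - 1, tau)]. *)
  case: ltnP => [tau_t|]; last by move/lowK.
  have t0 : (0 < t)%N by exact: leq_ltn_trans tau_t.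
  have kP : (tau <= t.-1 < T.-1)%N.
    by apply/andP; split; [rewrite -ltnS|rewrite ltn_predRL]; rewrite prednK.
  rewrite /noise_gain insubT /= prednK//.
  by rewrite !valK.
Qed.

Lemma stack_space p : @sdp_space R T n m (stack p).
Proof.
by move=> t tau; rewrite leqNgt => /negbTE tau_t; rewrite mxblockK tau_t.
Qed.

Lemma stack_bij : set_bij setT (@sdp_space R T n m) (@stack R T n m).
Proof.
split; first by move=> p _; exact: stack_space.
  by move=> p p' _ _; exact: stack_inj.
by move=> v vS; exists (unstack v); rewrite ?unstackK.
Qed.

End Stack.

(** * Moments of the stacked noise *)

Section StackedNoise.
Context {R : realType} {d : measure_display} {Omega : measurableType d}.
Variable P : probability Omega R.
Variables (T n : nat).

(** A functional of the stack is a sum of functionals of its independent blocks; these are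
    uncorrelated, so their second moments add up to the block diagonal form. *)
Lemma stacked_noise_centered (mu0 : 'cV[R]_n) (S W : 'M[R]_n)
    (x0 : Omega -> 'cV[R]_n) (w : 'I_T -> Omega -> 'cV[R]_n) :
  psdmx S -> psdmx W -> normal_vec P x0 mu0 S ->
  (forall t, normal_vec P (w t) 0 W) ->
  mutually_independent P
    (fun i : option 'I_T => if i is Some t then w t else x0) ->
  centered_rv P (fun omega => col_mx (x0 omega - mu0) (\mxcol_(t < T) w t omega))
    (block_mx S 0 0 (\mxdiag_(t < T) W)).
Proof.
move=> psdS psdW nx0 nw indep a.
(* Uniform indexing of the blocks, their means and covariances, and the slices [b] of [a]. *)
pose X (i : option 'I_T) := if i is Some t then w t else x0.
pose c (i : option 'I_T) : 'cV[R]_n := if i is Some t then 0 else mu0.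
pose V (i : option 'I_T) := if i is Some t then W else S.
pose b (i : option 'I_T) : 'cV[R]_n :=
  if i is Some t then submxcol (dsubmx a) t else usubmx a.
have nX i : normal_vec P (X i) (c i) (V i) by case: i.
have psdV i : psdmx (V i) by case: i.
pose Y i omega := ((b i)^T *m (X i omega - c i)) 0 0.
have YP i := normal_vec_centered (nX i) (psdV i) (b i).
have aE : a = col_mx (b None) (\mxcol_(t < T) b (Some t)).
  by rewrite submxcolK vsubmxK.
have ZE : (fun omega => (a^T *m col_mx (x0 omega - mu0)
    (\mxcol_(t < T) w t omega)) 0 0) = (fun omega => \sum_i Y i omega).
  apply/funext => omega; rewrite aE tr_col_mx mul_row_col tr_mxcol.
  rewrite mul_mxrow_mxcol mxE summxE big_optionE; congr (_ + _).
  by apply: eq_bigr => t _; rewrite /Y subr0.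
have Y2 i : Y i \in Lfun P 2%:E by have [] := YP i.
have Y0 i : ('E_P[Y i] = 0)%E by have [] := YP i.
split.
- by rewrite ZE; apply: Lfun_sumr => //; rewrite lee1n.
- by rewrite ZE expectation_sumr ?big1// => i; exact: Lfun2_1.
transitivity ('E_P[fun omega => ((\sum_i Y i omega) ^+ 2)%R])%E.
  by congr expectation; apply/funext => omega; rewrite (congr1 (fun f => f omega) ZE).
rewrite expectation_sqr_sum_uncorrelated//; last first.
  move=> i j ij; apply: (indep_functional_uncorrelated (b i) (b j) (nX i) (nX j)) => //.
  move=> A1 A2 mA1 mA2.
  (* Mutual independence restricted to a pair; since [i != j], the event chosen at [j] is [A2]. *)
  have := indep [set i; j]%SET (fun k => if k == i then A1 else A2).
  rewrite big_setU1 ?inE//= big_set1 eqxx (eq_sym j i) (negbTE ij) => <-.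
    congr (P _); apply/seteqP; split => omega /=.
      move=> [Ai Aj] k; rewrite /= !inE => /orP[]/eqP ->; first by rewrite eqxx.
      by rewrite (eq_sym j i) (negbTE ij).
    move=> H; split.
      by have := H i; rewrite /= !inE eqxx; apply.
    by have := H j; rewrite /= !inE eqxx orbT (eq_sym j i) (negbTE ij); apply.
  by move=> k; case: ifP.
transitivity (\sum_i (((b i)^T *m V i *m b i) 0 0)%:E)%E.
  by apply: eq_bigr => i _; have [] := YP i.
rewrite sumEFin; congr EFin.
rewrite aE tr_col_mx mul_row_block mul_row_col !mulmx0 addr0 add0r.
rewrite tr_mxcol mul_mxrow_mxdiag mul_mxrow_mxcol mxE summxE big_optionE.
by [].
Qed.

End StackedNoise.

(** * Affine maps and convexity of nonnegative quadratic forms *)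

Section AffineQuadratic.
Local Open Scope convex_scope.
Variable R : realType.

Lemma affine_map_linear (U V : lmodType R) (f l : U -> V) c :
  linear l -> (forall x, f x = l x + c) -> affine_map f.
Proof.
move=> lin_l fE; pose L := GRing.isLinear.Build R U V *:%R l lin_l.
by exists (HB.pack l L : {linear U -> V}), c.
Qed.

Lemma linear_comb (U V : lmodType R) (f : U -> V) s t x y :
  linear f -> f (s *: x + t *: y) = s *: f x + t *: f y.
Proof.
move=> lin_f; have f0 : f 0 = 0.
  by have := lin_f (-1) 0 0; rewrite scaler0 addr0 scaleN1r addNr.
by rewrite lin_f -[X in _ + f X]addr0 lin_f f0 addr0.
Qed.

(** The convexity gap at weight [s] is [s (1 - s) b (x - y) (x - y)]. *)
Lemma convex_bilinear (U : lmodType R) (b : U -> U -> R^o) :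
  (forall x, linear (b x)) -> (forall y, linear (b^~ y)) ->
  (forall x, 0 <= b x x) ->
  @convex_function R U setT (fun x => b x x).
Proof.
move=> linr linl b0 t x y _ _.
set s : R := t%:num; have s0 : 0 <= s by rewrite /s; exact: ge0.
have s1 : s <= 1 by rewrite /s; exact: le1.
have -> : x <| t |> y = s *: (x : U) + (1 - s) *: (y : U) by [].
have -> : b x x <| t |> b y y = s * b x x + (1 - s) * b y y by [].
rewrite (linear_comb _ _ _ _ (linl _)) !(linear_comb _ _ _ _ (linr _)).
(* [x - y], written as a combination that [linear_comb] can expand. *)
have := b0 (1 *: x + (-1) *: y).
rewrite (linear_comb _ _ _ _ (linl _)) !(linear_comb _ _ _ _ (linr _)).
rewrite /GRing.scale /=.
have : 0 <= s * (1 - s) by rewrite mulr_ge0// subr_ge0.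
nra.
Qed.

Lemma mxtrace_mul_tr_ge0 p q (M : 'M[R]_(p, q)) : 0 <= \tr (M *m M^T).
Proof.
rewrite /mxtrace sumr_ge0// => i _; rewrite mxE sumr_ge0// => j _.
by rewrite mxE -expr2 sqr_ge0.
Qed.

End AffineQuadratic.

(** * Convex quadratic cost and affine constraints of the program *)

Section SDPStructure.
Variables (R : realType) (T n m : nat).
Variables (A : 'I_T -> 'M[R]_n) (B : 'I_T -> 'M[R]_(n, m)) (S0 W : 'M[R]_n).
Let U := sdp_var R T n m.
Let Wd : 'M[R]_(blocks T n) := \mxdiag_(t < T) W.

Let sdp_form (x y : U) : R^o := (x.1.1^T *m y.1.1) 0 0
  + \tr (x.2 *m Wd *m y.2^T) + \tr (x.1.2 *m S0 *m y.1.2^T).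

Let sdp_form_linearr x : linear (sdp_form x).
Proof.
move=> a [[u L] K] [[u' L'] K']; rewrite /sdp_form /=.
rewrite mulmxDr -scalemxAr 2!mxE !linearP /GRing.scale /=.
ring.
Qed.

Let sdp_form_linearl y : linear (sdp_form^~ y).
Proof.
move=> a [[u L] K] [[u' L'] K']; rewrite /sdp_form /=.
rewrite linearP /= !mulmxDl -!scalemxAl 2!mxE !linearP /GRing.scale /=.
ring.
Qed.

Let sdp_costE v : sdp_cost S0 W v = sdp_form v v.
Proof. by case: v => [[u L] K]. Qed.

Lemma sdp_cost_quadratic : @quadratic_fun R U (sdp_cost S0 W).
Proof.
exists sdp_form, (fun=> 0); split => //.
  apply: (@affine_map_linear _ _ _ _ (fun=> 0) 0); last by move=> x; rewrite addr0.
  by move=> a x y; rewrite scaler0 addr0.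
by move=> v; rewrite sdp_costE addr0.
Qed.

(** Merges the two traces into [tr (M C M^T)] with [M = [L K]], the shape in which the expected cost
    arises. *)
Lemma sdp_cost_row_mx u L K : @sdp_cost R T n m S0 W (u, L, K) = (u^T *m u) 0 0
  + \tr (row_mx L K *m block_mx S0 0 0 Wd *m (row_mx L K)^T).
Proof.
rewrite /sdp_cost mul_row_block !mulmx0 addr0 add0r tr_row_mx mul_row_col.
by rewrite mxtraceD -addrA [\tr (K *m _ *m _) + _]addrC.
Qed.

(** Through [Rf] the trace term becomes [tr ((M Rf) (M Rf)^T)] with [M = [L K]], a sum of
    squares. *)
Lemma sdp_cost_convex q (Rf : 'M[R]_(n + blocks T n, q)) :
  Rf *m Rf^T = block_mx S0 0 0 Wd ->
  @convex_function R U setT (sdp_cost S0 W).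
Proof.
move=> hRf; rewrite (_ : sdp_cost S0 W = fun v => sdp_form v v); last first.
  by apply/funext => v; exact: sdp_costE.
apply: convex_bilinear => // -[[u L] K].
rewrite -sdp_costE sdp_cost_row_mx -hRf !mulmxA -mulmxA -trmx_mul.
rewrite addr_ge0 ?mxtrace_mul_tr_ge0// mxE sumr_ge0// => i _.
by rewrite mxE -expr2 sqr_ge0.
Qed.

Lemma sdp_mean_affine mu0 : @affine_map R U _ (sdp_mean A B mu0).
Proof.
apply: (@affine_map_linear _ _ _ _ (fun v : U => P_last *m (G_u A B *m v.1.1))
  (P_last *m (G_0 A *m mu0))).
  by move=> a x y /=; rewrite !linearP.
by move=> [[u L] K]; rewrite /sdp_mean mulmxDr.
Qed.

Lemma sdp_lmi_affine q (Rf : 'M[R]_(n + blocks T n, q)) Sd :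
  @affine_map R U _ (sdp_lmi A B Rf Sd).
Proof.
(* The linear part and the constant term of [zeta]. *)
pose lz (v : U) := P_last *m row_mx (G_u A B *m v.1.2) (G_u A B *m v.2) *m Rf.
pose z0 := P_last *m row_mx (G_0 A) (G_w A) *m Rf.
have zE (v : U) : zeta A B Rf v.1.2 v.2 = lz v + z0.
  by rewrite /zeta /lz /z0 -add_row_mx mulmxDr mulmxDl addrC.
have lin_lz : linear lz.
  move=> a x y; rewrite /lz /= !linearP /=.
  by rewrite -add_row_mx -scale_row_mx mulmxDr -scalemxAr mulmxDl -scalemxAl.
apply: (@affine_map_linear _ _ _ _ (fun v => block_mx 0 (lz v) (lz v)^T 0)
  (block_mx Sd z0 z0^T 1%:M)).
  move=> a x y; rewrite lin_lz linearP /= scale_block_mx add_block_mx.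
  by rewrite !scaler0 !addr0.
move=> [[u L] K]; rewrite /sdp_lmi (zE (u, L, K)) linearD /= add_block_mx.
by rewrite !add0r.
Qed.

End SDPStructure.

(** * Cost and feasibility of the closed loop in stacked form *)

Section ClosedLoop.
Context {R : realType} {d : measure_display} {Omega : measurableType d}.
Variable P : probability Omega R.
Variables (T n m q : nat).
Variables (A : 'I_T -> 'M[R]_n) (B : 'I_T -> 'M[R]_(n, m)).
Variables (mu0 : 'cV[R]_n) (S0 W : 'M[R]_n).
Variables (x0 : Omega -> 'cV[R]_n) (w : 'I_T -> Omega -> 'cV[R]_n).
Let C := block_mx S0 0 0 (\mxdiag_(t < T) W).
Let Z omega := col_mx (x0 omega - mu0) (\mxcol_(t < T) w t omega).
Hypothesis ZC : centered_rv P Z C.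

(** The sum of the squared inputs over time is the squared norm of the stacked input, an affine
    image of [Z]. *)
Lemma hccs_costE (p : controller R T n m) :
  hccs_cost P mu0 x0 w p = (sdp_cost S0 W (stack p))%:E.
Proof.
rewrite sdp_cost_row_mx -(expectation_sqr_norm (centered_rv_mulmx _ ZC)).
congr expectation; apply/funext => omega; rewrite -policy_stacked.
by rewrite tr_mxcol mul_mxrow_mxcol summxE.
Qed.

Lemma stateE (p : controller R T n m) omega :
  state A B mu0 x0 w p T omega = sdp_mean A B mu0 (stack p)
    + P_last *m row_mx (G_0 A + G_u A B *m stacked_init p)
                       (G_w A + G_u A B *m stacked_noise p) *m Z omega.
Proof.
rewrite /state trajectory_stacked policy_stacked /Z.
(* Writing [x0] as [e + mu0] sends [G_0 mu0] to the mean and leaves [e], the first block of [Z], in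
   the fluctuation. *)
set e := x0 omega - mu0; have -> : x0 omega = e + mu0 by rewrite subrK.
rewrite -!mulmxA /= -mulmxDr; congr (_ *m _).
rewrite !mul_row_col !mulmxDr !mulmxDl -!mulmxA.
move: (G_0 A *m e) (G_0 A *m mu0) (G_w A *m _) (G_u A B *m stacked_mean p).
move: (G_u A B *m (stacked_init p *m e)) (G_u A B *m (_ *m _)) => a1 a2 a3 a4 a5 a6.
by apply/matrixP => i j; rewrite !mxE; ring.
Qed.

Lemma hccs_feasibleE (Rf : 'M[R]_(n + blocks T n, q)) mud Sd (p : controller R T n m) :
  Rf *m Rf^T = C -> Sd^T = Sd ->
  hccs_feasible P A B mu0 x0 w mud Sd p
    <-> sdp_feasible A B mu0 Rf mud Sd (stack p).
Proof.
move=> hRf Sdsym; have Csym : C^T = C by rewrite -hRf trmx_mul trmxK.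
pose N := P_last *m row_mx (G_0 A + G_u A B *m stacked_init p)
  (G_w A + G_u A B *m stacked_noise p).
have sE : state A B mu0 x0 w p T
    = fun omega => sdp_mean A B mu0 (stack p) + N *m Z omega.
  by apply/funext => omega; exact: stateE.
have NC := centered_rv_mulmx N ZC.
have varE : var_mx P (state A B mu0 x0 w p T) =
    zeta A B Rf (stacked_init p) (stacked_noise p)
    *m (zeta A B Rf (stacked_init p) (stacked_noise p))^T.
  rewrite sE (var_mx_centered NC).
    by rewrite -hRf /zeta -/N [(N *m Rf)^T]trmx_mul !mulmxA.
  by rewrite trmx_mul trmxK trmx_mul Csym mulmxA.
rewrite /hccs_feasible /sdp_feasible /= varE /loewner_le -psdmx_schur//.
rewrite sE (mean_vec_centered NC).
(* A stacked controller always lies in [sdp_space], so only the other two constraints are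
   compared. *)
by split => [[]|[_ ? ?]]; split => //; exact: stack_space.
Qed.

End ClosedLoop.

Theorem theorem1 (R : realType) (d : measure_display)
    (Omega : measurableType d) (P : probability Omega R)
    (T n m q : nat) (hT : (1 <= T)%N)
    (A : 'I_T -> 'M[R]_n) (B : 'I_T -> 'M[R]_(n, m))
    (mu0 : 'cV[R]_n) (Sigma0 W : 'M[R]_n)
    (hSigma0 : pdmx Sigma0) (hW : psdmx W)
    (x0 : Omega -> 'cV[R]_n) (w : 'I_T -> Omega -> 'cV[R]_n)
    (hx0 : normal_vec P x0 mu0 Sigma0)
    (hw : forall t, normal_vec P (w t) 0 W)
    (hindep : mutually_independent P
                (fun i : option 'I_T => if i is Some t then w t else x0))
    (Rf : 'M[R]_(n + blocks T n, q))
    (hRf : Rf *m Rf^T = block_mx Sigma0 0 0 (\mxdiag_(t < T) W))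
    (mud : 'cV[R]_n) (Sigmad : 'M[R]_n) (hSigmad : pdmx Sigmad) :
  let hfeas := hccs_feasible P A B mu0 x0 w mud Sigmad in
  let hcost := hccs_cost P mu0 x0 w in
  let sfeas := sdp_feasible A B mu0 Rf mud Sigmad in
  let scost := fun v => (sdp_cost Sigma0 W v)%:E in
  [/\ set_bij setT (@sdp_space R T n m) (@stack R T n m),
      (forall p, hfeas p <-> sfeas (stack p)) /\
      (forall p, hcost p = scost (stack p)),
      optimal_value hfeas hcost = optimal_value sfeas scost /\
      (forall p, minimizer hfeas hcost p <-> minimizer sfeas scost (stack p))
    & [/\ @quadratic_fun R (sdp_var R T n m) (sdp_cost Sigma0 W),
          @convex_function R (sdp_var R T n m) setT (sdp_cost Sigma0 W),
          @affine_map R (sdp_var R T n m) _ (sdp_mean A B mu0)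
        & @affine_map R (sdp_var R T n m) _ (sdp_lmi A B Rf Sigmad)]].
Proof.
move=> hfeas hcost sfeas scost.
have psdS0 : psdmx Sigma0.
  case: hSigma0 => sym pd; split => // x; have [->|/pd/ltW//] := eqVneq x 0.
  by rewrite mulmx0 mxE.
have ZC := stacked_noise_centered psdS0 hW hx0 hw hindep.
have feasE p : hfeas p <-> sfeas (stack p).
  by apply: (hccs_feasibleE A B ZC) => //; case: hSigmad.
have costE p : hcost p = scost (stack p) by exact: hccs_costE ZC p.
(* Feasible triples are strictly block lower triangular, hence stacks of controllers; this
   transports infima and competitors back from the program. *)
have sfeasE v : sfeas v -> exists2 p, hfeas p & stack p = v.
  move=> sv; have vE : stack (unstack v) = v by apply: unstackK; case: sv.
  by exists (unstack v) => //; apply/feasE; rewrite vE.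
split=> //.
- exact: stack_bij.
- split.
    congr ereal_inf; apply/seteqP; split => _ [p hp <-].
      by exists (stack p); [apply/feasE|rewrite costE].
    by have [p' hp' <-] := sfeasE _ hp; exists p'; rewrite ?costE.
  move=> p; split=> -[hp opt]; split; first exact/feasE.
  + by move=> v /sfeasE[p' hp' <-]; rewrite -!costE; exact: opt.
  + exact/feasE.
  + by move=> p' /feasE hp'; rewrite !costE; exact: opt.
- split; [exact: sdp_cost_quadratic|exact: sdp_cost_convex hRf|
          exact: sdp_mean_affine|exact: sdp_lmi_affine].
Qed.
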